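(* Let $A, E \in \mathbb{R}^{n \times n}$ with $E$ invertible, $B, S \in \mathbb{R}^{n \times m}$, $C \in \mathbb{R}^{p \times n}$, $Q = Q^{T} \in \mathbb{R}^{p \times p}$, and $R = R^{T} \in \mathbb{R}^{m \times m}$ invertible. For symmetric $X \in \mathbb{R}^{n \times n}$ define $$\mathcal{R}(X) = A^{T} X E + E^{T} X A + C^{T} Q C - (B^{T} X E + S^{T})^{T} R^{-1} (B^{T} X E + S^{T}).$$ Assume that the equation $\mathcal{R}(X) = 0$ has a unique stabilizing solution $X_{\ast}$ (i.e., a unique symmetric solution such that all eigenvalues of $\lambda E - (A - B R^{-1}(B^{T} X_{\ast} E + S^{T}))$ lie in the open left complex half-plane). Let $K_{0} \in \mathbb{R}^{m \times n}$ be such that all eigenvalues of $\lambda E - (A - B K_{0})$ lie in the open left complex half-plane, and let either $R > 0$ or $R < 0$ be true. Let $(X_{k})_{k \geq 1}$ and $(K_{k})_{k \geq 0}$ be the exact Newton-Kleinman iterates started from $K_{0}$, that is, for $k = 0, 1, 2, \ldots$, with $A_{k} = A - B K_{k}$, the matrix $X_{k+1}$ is the exact solution of the Lyapunov equation $$A_{k}^{T} X_{k+1} E + E^{T} X_{k+1} A_{k} + W_{k}^{T} T W_{k} = 0, \quad W_{k} = \begin{bmatrix} C \\ R^{-1} S^{T} \\ K_{k} - R^{-1} S^{T} \end{bmatrix}, \quad T = \begin{bmatrix} Q & 0 & 0 \\ 0 & -R & 0 \\ 0 & 0 & R \end{bmatrix},$$ and $K_{k+1} = R^{-1}(B^{T}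 X_{k+1} E + S^{T})$. Then: (i) the closed-loop pencils $\lambda E - A_{k}$ with $A_{k} = A - B K_{k}$ are stable for all $k \geq 0$; (ii) $\lim_{k \to \infty} X_{k} = X_{\ast}$ and $\lim_{k \to \infty} \mathcal{R}(X_{k}) = 0$; (iii) the iterates $X_{k}$ converge globally and quadratically to $X_{\ast}$; (iv) if $R > 0$, then $$X_{1} \geq \cdots \geq X_{k} \geq X_{k+1} \geq \cdots \geq X_{\ast},$$ and if $R < 0$, then $$X_{1} \leq \cdots \leq X_{k} \leq X_{k+1} \leq \cdots \leq X_{\ast}.$$
   Context: All matrices are real and $M^{T}$ denotes the transpose of $M$. For symmetric matrices, $M > 0$ ($M < 0$) means that $M$ is positive (negative) definite, and $M \geq N$ ($M \leq N$) means that $M - N$ is symmetric positive semi-definite (symmetric negative semi-definite). The eigenvalues of a matrix pencil $\lambda E - M$ with $E$ invertible are the $\lambda \in \mathbb{C}$ with $\det(\lambda E - M) = 0$. The pencil is called stable (Hurwitz) if all its eigenvalues lie in the open left complex half-plane. In (iii), ''globally'' means that the convergence holds for every initial feedback $K_{0}$ for which $\lambda E - (A - B K_{0})$ is stable. ''Quadratically'' means that there is a constant $c \geq 0$ such that $\|X_{k+1} - X_{\ast}\| \leq c \|X_{k} - X_{\ast}\|^{2}$ for all $k \geq 1$, for a (any) fixed matrix norm. *)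

(* Defs.v *)
From HB Require Import structures.
From mathcomp Require Import all_boot all_order all_algebra.
From mathcomp Require Import complex.
From mathcomp Require Import all_classical all_reals all_analysis.

Set Implicit Arguments.
Unset Strict Implicit.
Unset Printing Implicit Defensive.

Import Order.TTheory GRing.Theory Num.Theory.
Import numFieldNormedType.Exports.

Local Open Scope classical_set_scope.
Local Open Scope ring_scope.

Section Definiteness.
Variables (F : realType) (n : nat).
Implicit Types M N : 'M[F]_n.

Definition quadform M (x : 'cV[F]_n) : F := (x^T *m M *m x) 0 0.

Definition posdefmx M := M^T = M /\ forall x, x != 0 -> 0 < quadform M x.
Definition negdefmx M := M^T = M /\ forall x, x != 0 -> quadform M x < 0.
Definition possemidefmx M := M^T = M /\ forall x, 0 <= quadform M x.
Definition negsemidefmx M := M^T = M /\ forall x, quadform M x <= 0.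

Definition loewner_ge M N := possemidefmx (M - N).
Definition loewner_le M N := negsemidefmx (M - N).

End Definiteness.

Section Pencil.
Variables (F : realType) (n : nat).
Implicit Types E M : 'M[F]_n.

Definition complexmx M : 'M[F[i]]_n := map_mx (real_complex F) M.

(* Eigenvalues of the pencil lambda E - M; only meant for invertible E, so
   that there is no eigenvalue at infinity. *)
Definition pencil_eigenvalue E M (lambda : F[i]) :=
  \det (lambda *: complexmx E - complexmx M) = 0.

Definition pencil_stable E M :=
  forall lambda : F[i], pencil_eigenvalue E M lambda -> complex.Re lambda < 0.

End Pencil.

Section Riccati.
Variables (F : realType) (n m p : nat).
Variables (A E : 'M[F]_n) (B S : 'M[F]_(n, m)) (C : 'M[F]_(p, n)).
Variables (Q : 'M[F]_p) (R : 'M[F]_m).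

Definition riccati (X : 'M[F]_n) : 'M[F]_n :=
  A^T *m X *m E + E^T *m X *m A + C^T *m Q *m C
  - (B^T *m X *m E + S^T)^T *m invmx R *m (B^T *m X *m E + S^T).

Definition feedback (X : 'M[F]_n) : 'M[F]_(m, n) :=
  invmx R *m (B^T *m X *m E + S^T).

Definition stabilizing_solution (X : 'M[F]_n) :=
  [/\ X^T = X, riccati X = 0 & pencil_stable E (A - B *m feedback X)].

Definition nk_W (K : 'M[F]_(m, n)) : 'M[F]_(p + (m + m), n) :=
  col_mx C (col_mx (invmx R *m S^T) (K - invmx R *m S^T)).

Definition nk_T : 'M[F]_(p + (m + m)) :=
  block_mx Q 0 0 (block_mx (- R) 0 0 R).

Definition nk_lyapunov (K : 'M[F]_(m, n)) (X : 'M[F]_n) :=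
  let AK := A - B *m K in
  AK^T *m X *m E + E^T *m X *m AK + (nk_W K)^T *m nk_T *m nk_W K = 0.

(* The iterates X_k are indexed by k >= 1: the value X 0 is unconstrained. *)
Definition newton_kleinman (K0 : 'M[F]_(m, n)) (X : nat -> 'M[F]_n)
    (K : nat -> 'M[F]_(m, n)) :=
  K 0%N = K0 /\
  forall k : nat, nk_lyapunov (K k) (X k.+1) /\ K k.+1 = feedback (X k.+1).

End Riccati.

(* Submultiplicativity is not required. Nonnegativity follows. *)
Definition is_mxnorm (F : realType) (m n : nat) (nu : 'M[F]_(m, n) -> F) :=
  [/\ forall M N, nu (M + N) <= nu M + nu N,
      forall (a : F) M, nu (a *: M) = `|a| * nu M
    & forall M, nu M = 0 -> M = 0].

Definition quadratic_convergence (F : realType) (n : nat)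
    (X : nat -> 'M[F]_n) (Xlim : 'M[F]_n) :=
  (X k @[k --> \oo] --> Xlim) /\
  forall nu : 'M[F]_n -> F, is_mxnorm nu ->
    exists2 c : F, 0 <= c &
      forall k : nat, (1 <= k)%N ->
        nu (X k.+1 - Xlim) <= c * nu (X k - Xlim) ^+ 2.

(* Main.v *)
Require Import Defs.
From HB Require Import structures.
From mathcomp Require Import all_boot all_order all_algebra.
From mathcomp Require Import complex.
From mathcomp Require Import all_classical all_reals all_analysis.
From mathcomp Require Import ring lra.

(** Write [L_M(X) = M^T X E + E^T X M] for the Lyapunov operator of the pencil
    [lambda E - M], [|K|^2 = K^T R K], and [K_X] for the feedback of [X].

    Completing the square ([riccati_completion]) shows that, for symmetric [X]
    and every gain [K], the Riccati residual at [X] is the residual of the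
    Lyapunov equation of [K] at [X] minus [|K - K_X|^2].  Comparing this
    identity at two matrices for the same gain expresses the Lyapunov operator
    at a difference of iterates, or at the error [D_k = X_k - Xs], through
    squares alone.  With [A_k = A - B K_k] and [A_s = A - B K_Xs],
    - [L_{A_k}(D_{k+1}) = - |K_k - K_Xs|^2],
    - [L_{A_{k+1}}(X_{k+1} - X_{k+2}) = - |K_k - K_{k+1}|^2],
    - [L_{A_{k+1}}(D_{k+1}) = - |K_k - K_{k+1}|^2 - |K_{k+1} - K_Xs|^2],
    - [L_{A_s}(D_{k+1}) = |K_{k+1} - K_Xs|^2 - |K_k - K_{k+1}|^2].

    Let [R > 0].  By Lyapunov's theorem ([lyapunov_possemidef]), for a stable
    pencil [L_M(X) <= 0] forces [X >= 0]; the first two lines thus give the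
    ordering of the iterates.  Stability is inherited through the third line
    ([lyapunov_stable]): an eigenvector of the new pencil for an eigenvalue
    outside the open left half-plane would be killed by [K_k - K_{k+1}], hence
    would be an eigenvector of the old pencil too.

    Convergence and its rate come together from the last line.  Choose [P]
    with [L_{A_s}(P) = -1].  As [|K_k - K_{k+1}|^2 <= c t^2] with
    [t = tr (X_k - X_{k+1})], Lyapunov's theorem yields
    [D_{k+1} <= c t^2 P], so the traces [f_k = tr D_k] satisfy
    [f_{k+1} <= c' (f_k - f_{k+1})^2] ([newton_trace_bound]).  The sequence
    [f] decreases and is nonnegative, so its increments tend to [0] and the
    inequality makes [f] itself tend to [0]; it also gives
    [f_{k+1} <= c' f_k^2].  On semidefinite matrices the trace is equivalent to
    every norm, which turns this into the statements about [X_k].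

    Negating [X], [Q], [R] and [S] together preserves the Newton-Kleinman
    iteration and negates the Riccati operator, which settles [R < 0].

    Lyapunov's theorem is proved over the complex numbers, by induction on the
    dimension ([lyapunov_hform_ge0]). *)

Set Implicit Arguments.
Unset Strict Implicit.
Unset Printing Implicit Defensive.

Import Order.TTheory GRing.Theory Num.Theory.
Import numFieldNormedType.Exports.

Local Open Scope classical_set_scope.
Local Open Scope ring_scope.

(** * Hermitian forms and the complex Lyapunov inequality *)
Section Hermitian.
Local Open Scope sesquilinear_scope.
Variable C : numClosedFieldType.

Lemma adjmx_mul m n p (A : 'M[C]_(m, n)) (B : 'M[C]_(n, p)) :
  (A *m B)^t* = B^t* *m A^t*.
Proof. by rewrite trmx_mul map_mxM. Qed.

Lemma adjmxD m n (A B : 'M[C]_(m, n)) : (A + B)^t* = A^t* + B^t*.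
Proof. by rewrite linearD map_mxD. Qed.

Lemma adjmxZ m n a (A : 'M[C]_(m, n)) : (a *: A)^t* = a^* *: A^t*.
Proof. by rewrite linearZ map_mxZ. Qed.

Definition hform n (Y : 'M[C]_n) (x : 'rV[C]_n) : C := (x *m Y *m x^t*) 0 0.

Lemma row_adj_eq0 n (u : 'rV[C]_n) : (u *m u^t*) 0 0 = 0 -> u = 0.
Proof.
rewrite mxE => /eqP; rewrite psumr_eq0; last first.
  by move=> i _; rewrite !mxE mul_conjC_ge0.
move=> /allP u0; apply/rowP => i.
by have := u0 i (mem_index_enum _); rewrite !mxE mul_conjC_eq0 => /eqP.
Qed.

(** The minimum of the form is attained at [v], so a small step from [v] along
    [v Y] could decrease it to first order if [v Y] were nonzero. *)
Lemma hform_kernel n (Y : 'M[C]_n) v :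
  Y^t* = Y -> (forall x, 0 <= hform Y x) -> hform Y v = 0 -> v *m Y = 0.
Proof.
move=> Yh Yge0 v0; apply: row_adj_eq0; set u := v *m Y.
set b := (u *m u^t*) 0 0; set c := hform Y u.
have c0 : 0 <= c by apply: Yge0.
have b0 : 0 <= b.
  by rewrite /b mxE sumr_ge0// => i _; rewrite !mxE mul_conjC_ge0.
have c1 : c + 1 != 0 by rewrite gt_eqF// ltr_wpDl.
(* The form at [v - s u] is [- 2 s b + s^2 c], which this step makes negative
   unless [b = 0]; the denominator is [c + 1] since [c] may vanish. *)
pose s := b / (c + 1).
have sr : s^* = s by rewrite geC0_conj// divr_ge0// addr_ge0.
have E : hform Y (v - s *: u) = - 2 * s * b + s ^+ 2 * c.
  rewrite /hform -scaleNr adjmxD adjmxZ rmorphN /= sr.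
  rewrite mulmxDl !mulmxDr !mulmxDl -!scalemxAl -!scalemxAr -/u.
  have -> : v *m Y *m v^t* = 0 by apply/matrixP => i j; rewrite !ord1 [LHS]v0 mxE.
  have -> : u *m Y *m v^t* = u *m u^t* by rewrite -mulmxA /u adjmx_mul Yh.
  have E2 : u *m Y *m u^t* = c%:M by apply: mx11_scalar.
  have E1 : u *m u^t* = b%:M by apply: mx11_scalar.
  by rewrite E2 E1 !mxE eqxx !mulr1n; ring.
have := Yge0 (v - s *: u); rewrite E.
have -> : - 2 * s * b + s ^+ 2 * c = - (b ^+ 2 * ((c + 2) / (c + 1) ^+ 2)).
  by rewrite /s; field.
rewrite oppr_ge0 pmulr_lle0; last first.
  by rewrite divr_gt0 ?exprn_gt0// ltr_wpDl.
by move=> b2; apply/eqP; rewrite -sqrf_eq0 eq_le b2 exprn_ge0.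
Qed.

Lemma col'_row'1 m n (i : 'I_n.+1) (M : 'M[C]_(m, n.+1)) :
  col i M = 0 -> col' i M *m row' i 1%:M = M.
Proof.
move=> Mi0; apply/matrixP => k j; rewrite mxE.
have -> : \sum_t col' i M k t * row' i 1%:M t j =
          \sum_t M k (lift i t) * (1%:M : 'M[C]_n.+1) (lift i t) j.
  by apply: eq_bigr => t _; rewrite !mxE.
have := congr1 (fun N : 'cV_m => N k 0) Mi0; rewrite !mxE => Mki.
transitivity ((M *m 1%:M) k j); last by rewrite mulmx1.
by rewrite mxE (bigD1_ord i) //= Mki mul0r add0r.
Qed.

Lemma eigenvalue_tr n (G : 'M[C]_n) a : eigenvalue G^T a = eigenvalue G a.
Proof.
rewrite !eigenvalue_root_char; congr (root _ _).
rewrite /char_poly -det_tr; congr (\det _).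
by rewrite /char_poly_mx linearB /= tr_scalar_mx map_trmx trmxK.
Qed.

(** Induction on the dimension.  Take a left eigenvector [v] of [G], say
    [v G = l v].  The hypothesis at [v] reads [(l + l^* ) (v Y v^t* ) <= 0],
    hence [v Y v^t* >= 0].  Complete [v] by the rows of a matrix [P] that are
    [Y]-orthogonal to [v]: then [Y] becomes block diagonal in the new basis,
    and the lower right block of [G] satisfies the hypotheses with
    [P Y P^t*] in place of [Y].  The orthogonal complement exists even if
    [v Y v^t* = 0], because [v Y = 0] in that case. *)
Lemma lyapunov_hform_ge0 n (G Y : 'M[C]_n) :
  Y^t* = Y -> (forall l, eigenvalue G l -> l + l^* < 0) ->
  (forall x, hform (G *m Y + Y *m G^t*) x <= 0) -> forall x, 0 <= hform Y x.
Proof.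
elim: n G Y => [|n IH] G Y Yh Gst GY x.
  by rewrite /hform mxE big_ord0.
have [l lG] := eigenvalue_closed G (ltn0Sn n).
have /eigenvalueP [v vG v0] := lG.
have l0 := Gst _ lG.
set q := hform Y v.
have vGa : G^t* *m v^t* = l^* *: v^t* by rewrite -adjmx_mul vG adjmxZ.
have vL : hform (G *m Y + Y *m G^t*) v = (l + l^*) * q.
  rewrite /hform mulmxDr mulmxDl !mulmxA vG -[_ *m G^t* *m _]mulmxA vGa.
  by rewrite -!scalemxAl -scalemxAr -scalerDl mxE.
have q0 : 0 <= q by rewrite -(nmulr_rle0 _ l0) -vL GY.
(* If [v Y] were nonzero, the kernel lemma for [- (G Y + Y G^t* )] would make
   [- l^*] an eigenvalue of [G], on the wrong side of the imaginary axis. *)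
have vY0 : q = 0 -> v *m Y = 0.
  move=> qz; pose N := - (G *m Y + Y *m G^t*).
  have Nh : N^t* = N.
    rewrite /N -scaleN1r adjmxZ rmorphN rmorph1 adjmxD !adjmx_mul Yh trmxCK.
    by rewrite [_ + G *m _]addrC.
  have N0 y : 0 <= hform N y.
    by rewrite /hform mulmxN mulNmx mxE oppr_ge0 GY.
  have Nv : hform N v = 0.
    by rewrite /hform mulmxN mulNmx mxE [X in - X]vL qz mulr0 oppr0.
  have := hform_kernel Nh N0 Nv.
  rewrite mulmxN mulmxDr !mulmxA vG -scalemxAl => /eqP.
  rewrite oppr_eq0 addrC addr_eq0 => /eqP u.
  apply: contraTeq isT => u0.
  have : eigenvalue G (- l^*).
    rewrite -eigenvalue_tr; apply/eigenvalueP; exists (map_mx Num.conj (v *m Y));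
      last by rewrite map_mx_eq0.
    have := congr1 (map_mx Num.conj) u.
    rewrite /= map_mxM -scaleNr map_mxZ rmorphN /= => <-.
    congr (_ *m _); by apply/matrixP => i j; rewrite !mxE conjCK.
  move=> /Gst; rewrite rmorphN /= conjCK -opprD oppr_lt0 addrC => l1.
  by have := lt_trans l0 l1; rewrite ltxx.
(* [P0] is the standard basis without a pivot index of [v]; when [q = 0],
   the inverse [q^-1] is [0] and no correction of [P0] is necessary. *)
have [i vi] := rV0Pn _ v0.
pose P0 : 'M[C]_(n, n.+1) := row' i 1%:M.
pose b : 'cV[C]_n := q^-1 *: (P0 *m Y *m v^t*).
pose P := P0 - b *m v.
have PYv : P *m Y *m v^t* = 0.
  rewrite /P !mulmxBl -[b *m v *m _]mulmxA -[b *m _ *m v^t*]mulmxA.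
  have [qz|qnz] := eqVneq q 0.
    have -> : P0 *m Y *m v^t* = (v *m Y *m P0^t*)^t*.
      by rewrite !adjmx_mul Yh trmxCK mulmxA.
    by rewrite (vY0 qz) !mul0mx mulmx0 subr0 trmx0 map_mx0.
  have -> : v *m Y *m v^t* = q%:M by apply: mx11_scalar.
  by rewrite mul_mx_scalar scalerA mulfV// scale1r subrr.
have vYP : v *m Y *m P^t* = 0.
  have -> : v *m Y *m P^t* = (P *m Y *m v^t*)^t*.
    by rewrite !adjmx_mul trmxCK Yh mulmxA.
  by rewrite PYv trmx0 map_mx0.
have span m (M : 'M[C]_(m, n.+1)) : exists a : 'cV_m, exists N, M = a *m v + N *m P.
  pose a := (v 0 i)^-1 *: col i M; pose N := col' i (M - a *m v).
  exists (a + N *m b), N.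
  rewrite /P mulmxBr mulmxDl !mulmxA -addrA [_ *m v + (_ - _)]addrC subrK.
  rewrite /N col'_row'1 ?[a *m v + _]addrC ?subrK//.
  apply/matrixP => k j; rewrite !mxE big_ord1 !mxE.
  by rewrite mulrAC mulVf// mul1r subrr.
have free c (y : 'rV[C]_n) : c *: v + y *m P = 0 -> y = 0.
  rewrite /P mulmxBr mulmxA => E.
  have E1 : (c - (y *m b) 0 0) *: v + y *m P0 = 0.
    rewrite -{}E scalerBl -addrA; congr (_ + _); rewrite addrC; congr (_ - _).
    rewrite -mul_scalar_mx; congr (_ *m _).
    by apply/matrixP => ? ?; rewrite !ord1 !mxE eqxx.
  have yi k : (y *m P0) 0 (lift i k) = y 0 k.
    rewrite mxE (bigD1 k)//= big1 ?addr0; first by rewrite !mxE eqxx mulr1.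
    by move=> t tk; rewrite !mxE (inj_eq lift_inj) (negbTE tk) mulr0.
  have yi0 : (y *m P0) 0 i = 0.
    rewrite mxE big1// => t _; rewrite !mxE; case: eqP => [/eqP|]; last by rewrite mulr0.
    by rewrite eq_sym (negbTE (neq_lift _ _)).
  have c0 : c - (y *m b) 0 0 = 0.
    have := congr1 (fun M : 'rV_n.+1 => M 0 i) E1; rewrite mxE yi0 addr0 !mxE => /eqP.
    by rewrite mulf_eq0 (negbTE vi) orbF => /eqP.
  move: E1; rewrite c0 scale0r add0r => E1.
  by apply/rowP => k; rewrite -yi E1 !mxE.
clearbody P.
(* In the basis [v, P] the matrix [G] is block triangular, with diagonal
   blocks [l] and [N]. *)
have [a [N PG]] := span _ (P *m G).
pose Y' := P *m Y *m P^t*.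
have Y'h : Y'^t* = Y' by rewrite /Y' !adjmx_mul Yh trmxCK mulmxA.
have Y'ge0 y : 0 <= hform Y' y.
  apply: (IH N) => // [m|z].
    (* An eigenvector [w] of [N] lifts to [w P + c v] unless its eigenvalue
       is [l], which is an eigenvalue of [G] anyway. *)
    move=> /eigenvalueP [w wN w0]; have [->//|ml] := eqVneq m l.
    apply: Gst; apply/eigenvalueP; pose c := (w *m a) 0 0 / (m - l).
    exists (c *: v + w *m P); last by apply: contraNneq w0 => /free ->.
    rewrite mulmxDl -scalemxAl vG -mulmxA PG mulmxDr !mulmxA wN -scalemxAl addrA.
    rewrite scalerDr; congr (_ + _).
    have -> : w *m a = ((w *m a) 0 0)%:M by apply: mx11_scalar.
    rewrite mul_scalar_mx !scalerA -scalerDl; congr (_ *: _).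
    have ml' : m - l != 0 by rewrite subr_eq0.
    by rewrite /c; field.
  have -> : hform (N *m Y' + Y' *m N^t*) z = hform (G *m Y + Y *m G^t*) (z *m P).
    rewrite /hform; congr (fun_of_matrix _ 0 0).
    have E1 : N *m Y' = P *m G *m Y *m P^t*.
      by rewrite PG /Y' !mulmxDl -!mulmxA [v *m _]mulmxA vYP mulmx0 add0r.
    have E2 : Y' *m N^t* = P *m Y *m G^t* *m P^t*.
      have -> : Y' *m N^t* = (N *m Y')^t* by rewrite adjmx_mul Y'h.
      by rewrite E1 !adjmx_mul trmxCK Yh !mulmxA.
    by rewrite mulmxDr E1 E2 adjmx_mul !mulmxDr !mulmxDl !mulmxA.
  exact: GY.
have [c [y ->]] := span _ x.
have -> : hform Y (c *m v + y *m P) = c 0 0 * (c 0 0)^* * q + hform Y' y.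
  rewrite /hform adjmxD !adjmx_mul mulmxDl !mulmxDr !mulmxDl.
  rewrite !mulmxA.
  have -> : c *m v *m Y *m P^t* = 0 by rewrite -!mulmxA [v *m _]mulmxA vYP mulmx0.
  have -> : y *m P *m Y *m v^t* = 0 by rewrite -!mulmxA [P *m _]mulmxA PYv mulmx0.
  rewrite !mul0mx addr0 add0r [LHS]mxE /hform /Y' ?mulmxA; congr (_ + _).
  rewrite -[c *m v *m Y]mulmxA -[c *m _ *m v^t*]mulmxA.
  have -> : v *m Y *m v^t* = q%:M by apply: mx11_scalar.
  by rewrite mul_mx_scalar -scalemxAl !mxE big_ord1 !mxE mulrC.
by rewrite addr_ge0// mulr_ge0// mul_conjC_ge0.
Qed.

Lemma hform_eq0 n (Y : 'M[C]_n) : Y^t* = Y -> (forall x, hform Y x = 0) -> Y = 0.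
Proof.
move=> Yh Y0; apply/row_matrixP => i; rewrite row0 rowE.
by apply: hform_kernel => // x; rewrite Y0.
Qed.

(** A hermitian solution [H] is nonnegative together with [- H], hence [0].
    This applies to [Y + Y^t*], so that ['i Y] is hermitian, and then to ['i Y]. *)
Lemma lyapunov_inj n (G Y : 'M[C]_n) :
  (forall l, eigenvalue G l -> l + l^* < 0) ->
  G *m Y + Y *m G^t* = 0 -> Y = 0.
Proof.
move=> Gst GY.
have herm H : H^t* = H -> G *m H + H *m G^t* = 0 -> H = 0.
  move=> Hh GH; apply: hform_eq0 => // x; apply/eqP; rewrite eq_le.
  rewrite (lyapunov_hform_ge0 Hh Gst) ?andbT; last first.
    by move=> y; rewrite GH /hform mulmx0 mul0mx mxE.
  rewrite -oppr_ge0.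
  have -> : - hform H x = hform (- H) x by rewrite /hform mulmxN mulNmx [RHS]mxE.
  apply: lyapunov_hform_ge0 Gst _ _.
    by rewrite -scaleN1r adjmxZ rmorphN rmorph1 Hh.
  by move=> y; rewrite mulmxN mulNmx -opprD GH oppr0 /hform mulmx0 mul0mx mxE.
have GYa : G *m Y^t* + Y^t* *m G^t* = 0.
  have := congr1 (fun M => M^t*) GY; rewrite /= adjmxD !adjmx_mul trmxCK addrC => ->.
  by rewrite trmx0 map_mx0.
have E : Y^t* = - Y.
  apply/eqP; rewrite -addr_eq0; apply/eqP/herm.
    by rewrite adjmxD trmxCK addrC.
  by rewrite mulmxDr mulmxDl addrACA GYa GY addr0.
have /eqP : 'i *: Y = 0.
  apply: herm; first by rewrite adjmxZ E conjCi scalerN scaleNr opprK.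
  by rewrite -scalemxAl -scalemxAr -scalerDr GY scaler0.
by rewrite scaler_eq0 (negbTE (neq0Ci _)) => /eqP.
Qed.
End Hermitian.

(** * Real quadratic forms and stable pencils *)
Section QuadForm.
Variable F : realType.

Lemma quadformD n (M N : 'M[F]_n) x : quadform (M + N) x = quadform M x + quadform N x.
Proof. by rewrite /quadform mulmxDr mulmxDl [LHS]mxE. Qed.

Lemma quadformN n (M : 'M[F]_n) x : quadform (- M) x = - quadform M x.
Proof. by rewrite /quadform mulmxN mulNmx [LHS]mxE. Qed.

Lemma quadformB n (M N : 'M[F]_n) x : quadform (M - N) x = quadform M x - quadform N x.
Proof. by rewrite quadformD quadformN. Qed.

Lemma quadformZ n a (M : 'M[F]_n) x : quadform (a *: M) x = a * quadform M x.
Proof. by rewrite /quadform -scalemxAr -scalemxAl [LHS]mxE. Qed.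

Lemma quadform_congr m n (P : 'M[F]_(m, n)) N x :
  quadform (P^T *m N *m P) x = quadform N (P *m x).
Proof. by rewrite /quadform trmx_mul !mulmxA. Qed.

End QuadForm.

Section ComplexBridge.
Local Open Scope sesquilinear_scope.
Variable F : realType.
Local Notation C := F[i].

Definition rcmx m n (M : 'M[F]_(m, n)) : 'M[C]_(m, n) := map_mx (real_complex F) M.

Lemma rcmx_adj m n (M : 'M[F]_(m, n)) : (rcmx M)^t* = rcmx M^T.
Proof.
by apply/matrixP => i j; rewrite !mxE; exact: (conjc_real (M j i)).
Qed.

Lemma rcmx_rect m n (x : 'M[C]_(m, n)) :
  x = rcmx (map_mx (@complex.Re F) x) + 'i *: rcmx (map_mx (@complex.Im F) x).
Proof. by apply/matrixP => i j; rewrite !mxE {1}[x i j]complexE complexiE. Qed.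

(** With [x = a + i b], symmetry of [N] cancels the mixed terms
    [a N b^T] and [b N a^T]. *)
Lemma hform_complexmx n (N : 'M[F]_n) (x : 'rV[C]_n) : N^T = N ->
  hform (complexmx N) x =
  (quadform N (map_mx (@complex.Re F) x)^T + quadform N (map_mx (@complex.Im F) x)^T)%:C%C.
Proof.
move=> Ns; rewrite {1}[x]rcmx_rect.
set a := map_mx _ x; set b := map_mx _ x.
have ab : b *m N *m a^T = a *m N *m b^T.
  transitivity (b *m N *m a^T)^T; last by rewrite !trmx_mul trmxK Ns mulmxA.
  by rewrite [b *m _ *m _]mx11_scalar tr_scalar_mx.
rewrite /hform -[complexmx N]/(rcmx N) adjmxD adjmxZ !rcmx_adj /= conjCi.
rewrite mulmxDl !mulmxDr !mulmxDl -!(scalemxAl, scalemxAr) -!map_mxM.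
rewrite ab !scalerA mulrN -expr2 sqrCi opprK scale1r scaleNr.
rewrite /quadform !trmxK.
by rewrite addrA addrK -map_mxD [LHS]mxE; congr (_ %:C)%C; rewrite [LHS]mxE.
Qed.

Lemma conj_ReE (l : C) : l + Num.conj l = (2 * complex.Re l)%:C%C.
Proof. by rewrite -[Num.conj l]/(conjc l) addcJ rmorphM rmorph_nat. Qed.

Lemma pencil_eigenvalueP n (E M : 'M[F]_n) l :
  pencil_eigenvalue E M l <->
  exists2 x : 'rV[C]_n, x != 0 & x *m rcmx M^T = l *: (x *m rcmx E^T).
Proof.
rewrite /pencil_eigenvalue -det_tr; split.
  move=> /eqP /det0P [x x0]; rewrite linearB linearZ /= mulmxBr -scalemxAr => /eqP.
  rewrite subr_eq0 => /eqP E1; exists x => //.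
  by rewrite /rcmx -!map_trmx E1.
move=> [x x0 E1]; apply/eqP/det0P; exists x => //.
rewrite linearB linearZ /= mulmxBr -scalemxAr; apply/eqP; rewrite subr_eq0.
by move: E1; rewrite /rcmx -!map_trmx => ->.
Qed.

(** Congruence by [E^-1] reduces the generalized Lyapunov equation to the
    standard one for [G = (M E^-1)^T] with the same unknown, see [lyapmx_rc];
    the transpose is there because eigenvectors are rows. *)
Lemma pencil_stable_eigenvalue n (E M : 'M[F]_n) : E \in unitmx -> pencil_stable E M ->
  forall l : C, eigenvalue (rcmx (M *m invmx E)^T) l -> l + l^* < 0.
Proof.
move=> Eu st l /eigenvalueP [x xG x0].
rewrite conj_ReE (ltcR _ 0) pmulr_rlt0//; apply: st; apply/pencil_eigenvalueP.
exists (x *m rcmx (invmx E)^T).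
  apply: contraNneq x0 => E0.
  have : x *m rcmx (invmx E)^T *m rcmx E^T = 0 by rewrite E0 mul0mx.
  by rewrite -mulmxA -map_mxM -trmx_mul mulmxV// trmx1 /rcmx map_mx1 mulmx1 => ->.
rewrite -2!mulmxA -!map_mxM -!trmx_mul mulmxV// trmx1 /rcmx map_mx1 mulmx1.
exact: xG.
Qed.

End ComplexBridge.

(** * The generalized Lyapunov equation *)
Section Lyapunov.
Local Open Scope sesquilinear_scope.
Variables (F : realType) (n : nat).
Implicit Types E M X : 'M[F]_n.

Definition lyapmx E M X := M^T *m X *m E + E^T *m X *m M.

Lemma lyapmx_rc E M X : E \in unitmx ->
  let G := rcmx (M *m invmx E)^T in
  G *m rcmx X + rcmx X *m G^t* = rcmx ((invmx E)^T *m lyapmx E M X *m invmx E).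
Proof.
move=> Eu /=; rewrite rcmx_adj trmxK /rcmx -!map_mxM -map_mxD; congr map_mx.
rewrite /lyapmx mulmxDr mulmxDl !mulmxA -trmx_mul -[_ *m E *m _]mulmxA mulmxV// mulmx1.
by rewrite -[(invmx E)^T *m E^T]trmx_mul mulmxV// trmx1 mul1mx.
Qed.

Lemma lyapmx_tr E M X : (lyapmx E M X)^T = lyapmx E M X^T.
Proof. by rewrite /lyapmx linearD /= !trmx_mul !trmxK addrC !mulmxA. Qed.

Lemma lyapmx_sym E M X : X^T = X -> (lyapmx E M X)^T = lyapmx E M X.
Proof. by move=> Xs; rewrite lyapmx_tr Xs. Qed.

(** Lyapunov's theorem.  Its hypothesis extends to complex vectors through
    their real and imaginary parts, and its conclusion is the complex one at
    real vectors. *)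
Lemma lyapunov_possemidef E M X : E \in unitmx -> pencil_stable E M -> X^T = X ->
  (forall x, quadform (lyapmx E M X) x <= 0) -> possemidefmx X.
Proof.
move=> Eu st Xs LX; split=> // x.
have Xh : (rcmx X)^t* = rcmx X by rewrite rcmx_adj Xs.
have := lyapunov_hform_ge0 Xh (pencil_stable_eigenvalue Eu st) _ (rcmx x^T).
rewrite (hform_complexmx _ Xs).
have -> : map_mx (@complex.Re F) (rcmx x^T) = x^T by apply/matrixP => i j; rewrite !mxE.
have -> : map_mx (@complex.Im F) (rcmx x^T) = 0 by apply/matrixP => i j; rewrite !mxE.
have q0 : quadform X 0 = 0 by rewrite /quadform mulmx0 mxE.
rewrite trmxK trmx0 q0 addr0 (lecR 0); apply.
move=> y; rewrite lyapmx_rc// hform_complexmx; last first.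
  by rewrite !trmx_mul trmxK lyapmx_sym// mulmxA.
by rewrite !quadform_congr (lecR _ 0) -oppr_ge0 opprD addr_ge0 ?oppr_ge0 ?LX.
Qed.

Lemma lyapmx_inj E M X : E \in unitmx -> pencil_stable E M ->
  lyapmx E M X = 0 -> X = 0.
Proof.
move=> Eu st LX; have := lyapmx_rc M X Eu.
rewrite LX mulmx0 mul0mx [in X in _ = X -> _]/rcmx map_mx0.
move=> /(lyapunov_inj (pencil_stable_eigenvalue Eu st)) /eqP.
by rewrite map_mx_eq0 => /eqP.
Qed.

Lemma lyapmxD E M X Y : lyapmx E M (X + Y) = lyapmx E M X + lyapmx E M Y.
Proof. by rewrite /lyapmx !(mulmxDr, mulmxDl) addrACA. Qed.

Lemma lyapmxZ E M a X : lyapmx E M (a *: X) = a *: lyapmx E M X.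
Proof. by rewrite /lyapmx -!(scalemxAr, scalemxAl) -scalerDr. Qed.

Lemma lyapmxN E M X : lyapmx E M (- X) = - lyapmx E M X.
Proof. by rewrite -scaleN1r lyapmxZ scaleN1r. Qed.

Lemma lyapmxB E M X Y : lyapmx E M (X - Y) = lyapmx E M X - lyapmx E M Y.
Proof. by rewrite lyapmxD lyapmxN. Qed.

Lemma lyapunov_sym E M X : E \in unitmx -> pencil_stable E M ->
  (lyapmx E M X)^T = lyapmx E M X -> X^T = X.
Proof.
move=> Eu st Ls; apply/eqP; rewrite -subr_eq0; apply/eqP.
by apply: (lyapmx_inj Eu st); rewrite lyapmxB -lyapmx_tr Ls subrr.
Qed.

(** An injective endomorphism of a finite-dimensional space is onto. *)
Lemma lyapunov_exists E M N : E \in unitmx -> pencil_stable E M ->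
  exists X, lyapmx E M X = N.
Proof.
move=> Eu st.
have lin : linear (lyapmx E M) by move=> a X Y; rewrite lyapmxD lyapmxZ.
pose f := HB.pack (lyapmx E M) (GRing.isLinear.Build _ _ _ _ (lyapmx E M) lin)
  : {linear 'M[F]_n -> 'M[F]_n}.
have fE X : f X = lyapmx E M X by [].
have fu : lin_mx f \in unitmx.
  rewrite -row_free_unit -kermx_eq0; apply/eqP/row_matrixP => i; rewrite row0.
  have := mulmx_ker (lin_mx f); set k := row i _ => kf.
  have : k *m lin_mx f = 0 by rewrite -row_mul kf row0.
  rewrite mul_rV_lin => /eqP; rewrite mxvec_eq0 fE => /eqP /(lyapmx_inj Eu st) k0.
  by rewrite -[k]vec_mxK k0 linear0.
exists (vec_mx (mxvec N *m invmx (lin_mx f))).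
by rewrite -fE; apply: (can_inj mxvecK); rewrite -mul_rV_lin mulmxKV.
Qed.

(** Let [x = a + i b] be an eigenvector of [lambda E - M] with
    [Re lambda >= 0].  The values of [lyapmx E M D] at [a] and [b] add up to
    [2 Re lambda] times a value of [E^T D E], which is nonnegative; both being
    nonpositive, they vanish.  Hence [M x = N x] and [lambda] is an eigenvalue
    of the stable pencil [lambda E - N]. *)
Lemma lyapunov_stable E M N D : pencil_stable E N -> possemidefmx D ->
  (forall x, quadform (lyapmx E M D) x <= 0) ->
  (forall x, quadform (lyapmx E M D) x = 0 -> M *m x = N *m x) ->
  pencil_stable E M.
Proof.
move=> st [Ds D0] L0 LN l /[dup] lM /pencil_eigenvalueP [x x0 xM].
have [//|Rel] := ltP (complex.Re l) 0.
suff : complex.Re l < 0 by rewrite ltNge Rel.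
apply: st; apply/pencil_eigenvalueP; exists x => //; rewrite -xM.
pose a := (map_mx (@complex.Re F) x)^T; pose b := (map_mx (@complex.Im F) x)^T.
have hL : hform (rcmx (lyapmx E M D)) x = (l + l^*) * hform (rcmx (E^T *m D *m E)) x.
  have xMa : rcmx M *m x^t* = l^* *: (rcmx E *m x^t*).
    have := congr1 (fun Z => Z^t*) xM.
    by rewrite /= adjmxZ !adjmx_mul !rcmx_adj !trmxK.
  rewrite /hform /rcmx map_mxD !map_mxM -!/(rcmx _) mulmxDr mulmxDl !mulmxA xM.
  rewrite -[X in _ + X]mulmxA xMa -!(scalemxAl, scalemxAr) mulmxA -scalerDl.
  by rewrite [LHS]mxE.
have EDs : (E^T *m D *m E)^T = E^T *m D *m E by rewrite !trmx_mul trmxK Ds mulmxA.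
move: hL; rewrite (hform_complexmx _ (lyapmx_sym _ _ Ds)) (hform_complexmx _ EDs) -/a -/b.
rewrite conj_ReE -rmorphM => /complexI; rewrite !quadform_congr => hL.
have : 0 <= quadform (lyapmx E M D) a + quadform (lyapmx E M D) b.
  by rewrite hL !mulr_ge0// addr_ge0.
have := L0 a; have := L0 b => Lb La Lab.
have Ea : M *m a = N *m a by apply: LN; lra.
have Eb : M *m b = N *m b by apply: LN; lra.
have Ta : rcmx a^T *m rcmx N^T = rcmx a^T *m rcmx M^T.
  by rewrite -!map_mxM -!trmx_mul Ea.
have Tb : rcmx b^T *m rcmx N^T = rcmx b^T *m rcmx M^T.
  by rewrite -!map_mxM -!trmx_mul Eb.
have xE : x = rcmx a^T + 'i *: rcmx b^T by rewrite {1}[x]rcmx_rect !trmxK.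
by rewrite xE !mulmxDl -!scalemxAl Ta Tb.
Qed.
End Lyapunov.

(** * The entrywise sum norm and the trace *)
Section EntrySum.
Variable F : realType.

(** This norm is submultiplicative and, on semidefinite matrices, comparable
    with the trace. *)
Definition mxsum m n (M : 'M[F]_(m, n)) : F := \sum_i \sum_j `|M i j|.

Lemma mxsum_ge0 m n (M : 'M[F]_(m, n)) : 0 <= mxsum M.
Proof. by apply: sumr_ge0 => i _; apply: sumr_ge0. Qed.

Lemma le_mxsum m n (M : 'M[F]_(m, n)) i j : `|M i j| <= mxsum M.
Proof.
rewrite /mxsum (bigD1 i)//= (bigD1 j)//= -addrA lerDl addr_ge0//.
  exact: sumr_ge0.
by apply: sumr_ge0 => k _; apply: sumr_ge0.
Qed.

Lemma mxsumM m n p (M : 'M[F]_(m, n)) (N : 'M[F]_(n, p)) :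
  mxsum (M *m N) <= mxsum M * mxsum N.
Proof.
rewrite /mxsum mulr_suml ler_sum// => i _.
apply: (@le_trans _ _ (\sum_j \sum_k `|M i k| * `|N k j|)).
  apply: ler_sum => j _; rewrite mxE (le_trans (ler_norm_sum _ _ _))//.
  by apply: ler_sum => k _; rewrite normrM.
rewrite exchange_big /= mulr_suml ler_sum// => k _.
rewrite -mulr_sumr ler_wpM2l// (bigD1 k)//= lerDl.
by apply: sumr_ge0 => l _; apply: sumr_ge0.
Qed.

Lemma mxsumN m n (M : 'M[F]_(m, n)) : mxsum (- M) = mxsum M.
Proof. by apply: eq_bigr => i _; apply: eq_bigr => j _; rewrite mxE normrN. Qed.

Lemma quadform1 n (x : 'cV[F]_n) : quadform 1%:M x = \sum_i x i 0 ^+ 2.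
Proof. by rewrite /quadform mulmx1 mxE; apply: eq_bigr => i _; rewrite mxE expr2. Qed.

Lemma quadform1_ge0 n (x : 'cV[F]_n) : 0 <= quadform 1%:M x.
Proof. by rewrite quadform1 sumr_ge0// => i _; rewrite sqr_ge0. Qed.

Lemma quadform_le_mxsum n (M : 'M[F]_n) x :
  quadform M x <= mxsum M * quadform 1%:M x.
Proof.
have xi i : x i 0 ^+ 2 <= quadform 1%:M x.
  by rewrite quadform1 (bigD1 i)//= lerDl sumr_ge0// => j _; rewrite sqr_ge0.
have -> : quadform M x = \sum_i \sum_j M i j * (x i 0 * x j 0).
  rewrite /quadform -mulmxA mxE; apply: eq_bigr => i _.
  by rewrite !mxE mulr_sumr; apply: eq_bigr => j _; rewrite mulrCA.
rewrite /mxsum mulr_suml ler_sum// => i _; rewrite mulr_suml ler_sum// => j _.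
rewrite (le_trans (ler_norm _))// normrM ler_wpM2l// ler_norml.
by have := xi i; have := xi j; rewrite !expr2 => ? ?; apply/andP; split; nra.
Qed.

Lemma quadform_add_delta n (M : 'M[F]_n) i j s :
  quadform M (delta_mx i 0 + s *: delta_mx j 0) =
  M i i + s * (M i j + M j i) + s ^+ 2 * M j j.
Proof.
have d k l : (delta_mx 0 k : 'rV_n) *m M *m (delta_mx l 0 : 'cV_n) = (M k l)%:M.
  by rewrite -rowE -colE; apply/matrixP => a b; rewrite !ord1 !mxE.
rewrite /quadform [(_ + _)^T]linearD linearZ /= !trmx_delta !mulmxDl !mulmxDr.
rewrite -!(scalemxAl, scalemxAr) !d !mxE eqxx !mulr1n; ring.
Qed.

Lemma quadform_delta n (M : 'M[F]_n) i : quadform M (delta_mx i 0) = M i i.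
Proof. by have := quadform_add_delta M i i 0; rewrite scale0r addr0 => ->; ring. Qed.

Lemma psd_mxtrace_ge0 n (D : 'M[F]_n) : possemidefmx D -> 0 <= \tr D.
Proof.
by move=> [_ D0]; apply: sumr_ge0 => i _; rewrite -quadform_delta.
Qed.

(** Testing [D] on [e_i + e_j] and [e_i - e_j] gives
    [2 |D_ij| <= D_ii + D_jj]. *)
Lemma psd_mxsum_le n (D : 'M[F]_n) : possemidefmx D -> mxsum D <= n%:R * \tr D.
Proof.
move=> [Ds D0].
have Dij i j : `|D i j| <= (D i i + D j j) / 2.
  have := D0 (delta_mx i 0 + 1 *: delta_mx j 0).
  have := D0 (delta_mx i 0 + (-1) *: delta_mx j 0).
  rewrite !quadform_add_delta -[in D j i]Ds mxE ler_norml => ? ?.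
  by apply/andP; split; lra.
apply: (@le_trans _ _ (\sum_i \sum_j (D i i + D j j) / 2)).
  by apply: ler_sum => i _; apply: ler_sum => j _.
rewrite le_eqVlt; apply/orP; left; apply/eqP.
under eq_bigr do rewrite -mulr_suml big_split/= sumr_const card_ord -mulr_natl.
rewrite -mulr_suml big_split/= sumrMnl sumr_const card_ord.
rewrite -mulr_natl -[X in _ + X]mulr_natl.
by rewrite /mxtrace; field.
Qed.

Lemma mxtrace_le_mxsum n (D : 'M[F]_n) : \tr D <= mxsum D.
Proof.
apply: ler_sum => i _; rewrite (le_trans (ler_norm _))// (bigD1 i)//= lerDl.
exact: sumr_ge0.
Qed.

End EntrySum.

(** * Completing the square in the Riccati operator *)
Section Completion.
Variables (F : realType) (n m p : nat).
Variables (A E : 'M[F]_n) (B S : 'M[F]_(n, m)) (C : 'M[F]_(p, n)).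
Variables (Q : 'M[F]_p) (R : 'M[F]_m).

(** The left-hand side of the Lyapunov equation that defines the Newton step
    from the gain [K]. *)
Definition nk_residual K X :=
  lyapmx E (A - B *m K) X + (nk_W S C R K)^T *m nk_T Q R *m nk_W S C R K.

Lemma complete_square (K H : 'M[F]_(m, n)) : R^T = R -> R \in unitmx ->
  (K - invmx R *m H)^T *m R *m (K - invmx R *m H) =
  K^T *m R *m K - K^T *m H - H^T *m K + H^T *m invmx R *m H.
Proof.
move=> Rs Ru; rewrite [(_ - _)^T]linearB /= trmx_mul trmx_inv Rs.
rewrite !(mulmxBr, mulmxBl) !mulmxA mulmxKV// mulmxK//.
by rewrite opprD opprK addrA; congr (_ + _); rewrite addrAC.
Qed.

Lemma nk_weightE K : R^T = R -> R \in unitmx ->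
  (nk_W S C R K)^T *m nk_T Q R *m nk_W S C R K =
  C^T *m Q *m C + (K^T *m R *m K - K^T *m S^T - S *m K).
Proof.
move=> Rs Ru; rewrite /nk_W /nk_T !tr_col_mx !mul_row_block !mulmx0 !addr0 !add0r.
rewrite mul_row_col mul_row_col; congr (_ + _).
rewrite (complete_square _ _ Rs Ru) trmxK trmx_mul trmx_inv trmxK Rs.
by rewrite mulmxN mulNmx mulmxKV// mulmxA addrC addrK.
Qed.

(** The Riccati residual is the minimum over [K], when [R > 0], of the
    Lyapunov residuals [nk_residual K X]; it is attained at the feedback of
    [X], and the defect is a square. *)
Lemma riccati_completion K X : X^T = X -> R^T = R -> R \in unitmx ->
  riccati A E B S C Q R X =
  nk_residual K X -
  (K - feedback E B S R X)^T *m R *m (K - feedback E B S R X).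
Proof.
move=> Xs Rs Ru; rewrite /nk_residual nk_weightE// /feedback complete_square//.
rewrite /riccati /lyapmx [(_ - _)^T]linearB /= ![(_ + _)^T]linearD /= !trmx_mul !trmxK Xs.
rewrite !(mulmxDl, mulmxDr, mulmxBl, mulmxBr) !mulmxA.
rewrite !(mulNmx, mulmxN) !mulmxA.
move: (A^T *m X *m E) (E^T *m X *m A) (C^T *m Q *m C) (S *m K)
  (E^T *m X *m B *m invmx R *m B^T *m X *m E) (S *m invmx R *m B^T *m X *m E)
  (E^T *m X *m B *m invmx R *m S^T) (S *m invmx R *m S^T)
  (K^T *m B^T *m X *m E) (E^T *m X *m B *m K) (K^T *m R *m K) (K^T *m S^T).
move=> a1 a2 a3 a4 a5 a6 a7 a8 a9 a10 a11 a12.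
by apply/matrixP => i j; rewrite !mxE; ring.
Qed.

Lemma nk_residualB K X Y :
  lyapmx E (A - B *m K) (X - Y) = nk_residual K X - nk_residual K Y.
Proof. by rewrite /nk_residual lyapmxB [in RHS]opprD [RHS]addrACA subrr addr0. Qed.
End Completion.

(** * One Newton step for a positive weight *)
Section NewtonStep.
Variables (F : realType) (n m p : nat).
Variables (A E : 'M[F]_n) (B S : 'M[F]_(n, m)) (C : 'M[F]_(p, n)).
Variables (Q : 'M[F]_p) (R : 'M[F]_m).
Hypotheses (Eu : E \in unitmx) (Qs : Q^T = Q) (Ru : R \in unitmx) (Rpos : posdefmx R).
Local Notation Acl K := (A - B *m K).
Local Notation fb X := (feedback E B S R X).
Local Notation ric X := (riccati A E B S C Q R X).
Local Notation res K X := (nk_residual A E B S C Q R K X).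
Local Notation sq K := (K^T *m R *m K).

Let Rs : R^T = R. Proof. by case: Rpos. Qed.

Lemma quadform_sq_ge0 (K : 'M[F]_(m, n)) x : 0 <= quadform (sq K) x.
Proof.
rewrite quadform_congr; have [->|y0] := eqVneq (K *m x) 0.
  by rewrite /quadform mulmx0 mxE.
by rewrite ltW//; apply: Rpos.2.
Qed.

Lemma quadform_sq_eq0 (K : 'M[F]_(m, n)) x : quadform (sq K) x = 0 -> K *m x = 0.
Proof.
rewrite quadform_congr => Kx; have [//|y0] := eqVneq (K *m x) 0.
by have := Rpos.2 _ y0; rewrite Kx ltxx.
Qed.

Lemma res_sym K X : pencil_stable E (Acl K) -> res K X = 0 -> X^T = X.
Proof.
move=> st /eqP; rewrite addr_eq0 => /eqP LX; apply: (lyapunov_sym Eu st).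
have Ts : (nk_T Q R)^T = nk_T Q R.
  by rewrite /nk_T !tr_block_mx !trmx0 [(- R)^T]linearN /= Qs Rs.
by rewrite LX [(- _)^T]linearN /= !trmx_mul trmxK Ts !mulmxA.
Qed.

Lemma res_sub K X Y : lyapmx E (Acl K) (X - Y) = res K X - res K Y.
Proof. exact: nk_residualB. Qed.

Lemma res_completion K X : X^T = X -> res K X = ric X + sq (K - fb X).
Proof. by move=> Xs; rewrite (riccati_completion _ _ _ _ _ _ K Xs Rs Ru) subrK. Qed.

Lemma newton_riccati K X : pencil_stable E (Acl K) -> res K X = 0 ->
  ric X = - sq (K - fb X).
Proof.
move=> st KX; rewrite (riccati_completion _ _ _ _ _ _ K (res_sym st KX) Rs Ru).
by rewrite KX sub0r.
Qed.

(** At the feedback of [X], the Lyapunov residual of [X] is the Riccati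
    residual, which is minus a square by [newton_riccati]. *)
Lemma newton_sub_next K X X' : pencil_stable E (Acl K) -> res K X = 0 ->
  res (fb X) X' = 0 ->
  lyapmx E (Acl (fb X)) (X - X') = - sq (K - fb X).
Proof.
move=> st KX KX'; rewrite res_sub KX' subr0 res_completion ?(res_sym st KX)//.
by rewrite (newton_riccati st KX) subrr mulmx0 addr0.
Qed.

Section Solution.
Variable Xs : 'M[F]_n.
Hypotheses (Xss : Xs^T = Xs) (Xs0 : ric Xs = 0) (Xst : pencil_stable E (Acl (fb Xs))).

Lemma newton_sub_solution K X : res K X = 0 ->
  lyapmx E (Acl K) (X - Xs) = - sq (K - fb Xs).
Proof. by move=> KX; rewrite res_sub KX sub0r res_completion// Xs0 add0r. Qed.

Lemma newton_ge_solution K X : pencil_stable E (Acl K) -> res K X = 0 ->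
  possemidefmx (X - Xs).
Proof.
move=> st KX; apply: (lyapunov_possemidef Eu st).
  by rewrite linearB /= (res_sym st KX) Xss.
by move=> x; rewrite newton_sub_solution// quadformN oppr_le0 quadform_sq_ge0.
Qed.

(** The Lyapunov operator of the new pencil at [X - Xs] is minus the sum of
    two squares.  Where it vanishes, [K] and the new gain agree, and with them
    the two pencils. *)
Lemma newton_stable K X : pencil_stable E (Acl K) -> res K X = 0 ->
  pencil_stable E (Acl (fb X)).
Proof.
move=> st KX.
have L : lyapmx E (Acl (fb X)) (X - Xs) = - (sq (K - fb X) + sq (fb X - fb Xs)).
  rewrite res_sub !res_completion ?(res_sym st KX)// subrr mulmx0 addr0 Xs0 add0r.
  by rewrite (newton_riccati st KX) opprD.
apply: (lyapunov_stable st (newton_ge_solution st KX)) => x.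
  by rewrite L quadformN oppr_le0 quadformD addr_ge0 ?quadform_sq_ge0.
rewrite L quadformN quadformD => /eqP; rewrite oppr_eq0 paddr_eq0 ?quadform_sq_ge0//.
move=> /andP[/eqP /quadform_sq_eq0 + _].
rewrite !mulmxBl -!mulmxA => /eqP; rewrite subr_eq0 => /eqP ->.
by [].
Qed.

Lemma newton_monotone K X X' : pencil_stable E (Acl K) -> res K X = 0 ->
  res (fb X) X' = 0 -> possemidefmx (X - X').
Proof.
move=> st KX KX'; have st' := newton_stable st KX.
apply: (lyapunov_possemidef Eu st').
  by rewrite linearB /= (res_sym st KX) (res_sym st' KX').
by move=> x; rewrite (newton_sub_next st KX KX') quadformN oppr_le0 quadform_sq_ge0.
Qed.

Lemma fb_sub X X' : fb X - fb X' = invmx R *m B^T *m (X - X') *m E.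
Proof.
rewrite /feedback -mulmxBr opprD addrACA subrr addr0.
by rewrite -mulmxBl -mulmxBr !mulmxA.
Qed.

(** Feedbacks depend affinely on [X], so the square of their difference is
    quadratic in [X - X']; semidefiniteness lets the trace control it. *)
Lemma mxsum_sq_fb_sub : exists2 c, 0 <= c & forall X X', possemidefmx (X - X') ->
  mxsum (sq (fb X - fb X')) <= c * (\tr (X - X')) ^+ 2.
Proof.
pose G := invmx R *m B^T.
exists (mxsum E^T * mxsum (G^T *m R *m G) * mxsum E * n%:R ^+ 2).
  by rewrite !mulr_ge0 ?mxsum_ge0 ?exprn_ge0.
move=> X X' XX'; rewrite fb_sub -/G; set D := X - X' in XX' *.
have Ds : D^T = D by case: XX'.
have -> : sq (G *m D *m E) = E^T *m (D *m (G^T *m R *m G) *m D) *m E.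
  by rewrite !trmx_mul Ds !mulmxA.
have nD := psd_mxsum_le XX'; have D0 := mxsum_ge0 D.
set N := G^T *m R *m G; set d := mxsum D in nD D0.
apply: (@le_trans _ _ (mxsum E^T * (d * mxsum N * d) * mxsum E)).
  apply: (le_trans (mxsumM _ _)); apply: ler_wpM2r; first exact: mxsum_ge0.
  apply: (le_trans (mxsumM _ _)); apply: ler_wpM2l; first exact: mxsum_ge0.
  apply: (le_trans (mxsumM _ _)); apply: ler_wpM2r; first exact: mxsum_ge0.
  exact: mxsumM.
have -> : mxsum E^T * (d * mxsum N * d) * mxsum E = mxsum E^T * mxsum N * mxsum E * d ^+ 2.
  by ring.
rewrite -[leRHS]mulrA -exprMn; apply: ler_wpM2l.
  by rewrite !mulr_ge0 ?mxsum_ge0.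
by rewrite lerXn2r// nnegrE (le_trans D0).
Qed.

(** The Lyapunov operator of the pencil closed by [fb Xs], taken at [X' - Xs],
    is a square minus the square of [fb X - fb X'], hence at least [- w 1] with
    [w = c (tr (X - X'))^2].  If [P] is the matrix where this operator takes the
    value [-1], comparison gives [X' - Xs <= w P].  Measuring by the decrement
    [X - X'] instead of by the error is what makes this bound yield convergence
    as well as its order. *)
Lemma newton_trace_bound : exists2 c, 0 <= c & forall K X X',
  pencil_stable E (Acl K) -> res K X = 0 -> res (fb X) X' = 0 ->
  \tr (X' - Xs) <= c * (\tr (X - X')) ^+ 2.
Proof.
have [P LP] := lyapunov_exists (- 1%:M) Eu Xst.
have Psym : P^T = P.
  by apply: (lyapunov_sym Eu Xst); rewrite LP [(- _)^T]linearN /= trmx1.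
have P0 : possemidefmx P.
  apply: (lyapunov_possemidef Eu Xst Psym) => x.
  by rewrite LP quadformN oppr_le0 quadform1_ge0.
have [c c0 cN] := mxsum_sq_fb_sub.
exists (c * \tr P); first by rewrite mulr_ge0// psd_mxtrace_ge0.
move=> K X X' st KX KX'; have st' := newton_stable st KX.
have mono := newton_monotone st KX KX'.
have X's := res_sym st' KX'.
pose w := c * (\tr (X - X')) ^+ 2.
have : possemidefmx (w *: P - (X' - Xs)).
  apply: (lyapunov_possemidef Eu Xst).
    rewrite [(_ - _)^T]linearB /= [(w *: P)^T]linearZ /=.
    by rewrite [(X' - Xs)^T]linearB /= Psym X's Xss.
  move=> x; rewrite lyapmxB lyapmxZ LP res_sub !res_completion//.
  rewrite Xs0 subrr mulmx0 addr0 subr0.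
  rewrite (newton_riccati st' KX') quadformB quadformD quadformZ !quadformN.
  have := quadform_sq_ge0 (fb Xs - fb X') x.
  have := quadform_le_mxsum (sq (fb X - fb X')) x.
  have := cN _ _ mono; rewrite -/w => wN xN x0.
  have : mxsum (sq (fb X - fb X')) * quadform 1%:M x <= w * quadform 1%:M x.
    by rewrite ler_wpM2r// quadform1_ge0.
  lra.
move=> /psd_mxtrace_ge0; rewrite [\tr (_ - _)]linearB /= mxtraceZ subr_ge0.
by rewrite /w mulrAC.
Qed.

End Solution.
End NewtonStep.

(** * Equivalence of matrix norms and convergence *)
Section MatrixNorms.
Variable F : realType.

Lemma norm_le_mxsum m n (M : 'M[F]_(m, n)) : `|M| <= mxsum M.
Proof.
rewrite [leLHS]/Num.Def.normr /= mx_normrE; apply: bigmax_le; first exact: mxsum_ge0.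
by move=> [i j] _ /=; exact: le_mxsum.
Qed.

Lemma entry_le_norm m n (M : 'M[F]_(m, n)) i j : `|M i j| <= `|M|.
Proof.
by rewrite [leRHS]/Num.Def.normr /= mx_normrE; apply/bigmax_geP; right; exists (i, j).
Qed.

Lemma mxsum_le_norm m n (M : 'M[F]_(m, n)) : mxsum M <= m%:R * n%:R * `|M|.
Proof.
apply: (@le_trans _ _ (\sum_(i < m) \sum_(j < n) `|M|)).
  by apply: ler_sum => i _; apply: ler_sum => j _; exact: entry_le_norm.
by rewrite !sumr_const !card_ord -[leLHS]mulr_natl -[`|M| *+ n]mulr_natl mulrA.
Qed.

Section ArbitraryNorm.
Variables (m n : nat) (nu : 'M[F]_(m, n) -> F).
Hypothesis nuP : is_mxnorm nu.

Lemma mxnorm0 : nu 0 = 0.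
Proof. by case: nuP => _ nuZ _; rewrite -(scale0r 0) nuZ normr0 mul0r. Qed.

Lemma mxnormN M : nu (- M) = nu M.
Proof. by case: nuP => _ nuZ _; rewrite -scaleN1r nuZ normrN1 mul1r. Qed.

Lemma mxnorm_ge0 M : 0 <= nu M.
Proof.
case: nuP => nuD _ _; have := nuD M (- M).
by rewrite subrr mxnorm0 mxnormN; lra.
Qed.

Lemma mxnorm_gt0 M : M != 0 -> 0 < nu M.
Proof.
move=> M0; rewrite lt_neqAle mxnorm_ge0 andbT eq_sym.
by apply: contraNneq M0 => /(let: And3 _ _ h := nuP in h _) ->.
Qed.

Lemma mxnorm_sum (I : Type) (r : seq I) (f : I -> 'M[F]_(m, n)) :
  nu (\sum_(i <- r) f i) <= \sum_(i <- r) nu (f i).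
Proof.
elim/big_ind2: _ => //; first by rewrite mxnorm0.
by move=> M a N b Ma Nb; case: nuP => nuD _ _; rewrite (le_trans (nuD _ _))// lerD.
Qed.

Lemma mxnorm_le_mxsum : exists2 a, 0 <= a & forall M, nu M <= a * mxsum M.
Proof.
exists (\sum_i \sum_j nu (delta_mx i j)).
  by apply: sumr_ge0 => i _; apply: sumr_ge0 => j _; exact: mxnorm_ge0.
move=> M; rewrite {1}[M]matrix_sum_delta mulr_suml.
rewrite (le_trans (mxnorm_sum _ _))// ler_sum// => i _; rewrite mulr_suml.
rewrite (le_trans (mxnorm_sum _ _))// ler_sum// => j _.
case: nuP => _ nuZ _; rewrite nuZ mulrC ler_wpM2l ?mxnorm_ge0//; exact: le_mxsum.
Qed.

(** The norm [nu] is Lipschitz for the maximum norm, hence attains a positive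
    minimum on its compact unit sphere; homogeneity does the rest. *)
Lemma mxsum_le_mxnorm : exists2 b, 0 <= b & forall M, mxsum M <= b * nu M.
Proof.
have [a a0 nua] := mxnorm_le_mxsum.
pose h (v : 'rV[F]_(m * n)) := nu (vec_mx v).
pose N : F := m%:R * n%:R.
have N0 : 0 <= N by rewrite mulr_ge0.
have vec_le (v : 'rV[F]_(m * n)) : mxsum (vec_mx v) <= N * `|v|.
  apply: (le_trans (mxsum_le_norm _)); apply: ler_wpM2l => //.
  rewrite [leLHS]/Num.Def.normr /= mx_normrE; apply: bigmax_le => // -[i j] _ /=.
  by rewrite mxE; exact: entry_le_norm.
have hlip u v : `|h u - h v| <= a * N * `|u - v|.
  have lip1 x y : h x - h y <= a * N * `|x - y|.
    rewrite lerBlDr /h -{1}[x](subrK y) linearD /=.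
    case: nuP => nuD _ _; rewrite (le_trans (nuD _ _))// lerD2r.
    by rewrite (le_trans (nua _))// -mulrA ler_wpM2l.
  by rewrite ler_norml lip1 andbT lerNl opprB distrC lip1.
have hcont : continuous h.
  move=> v; apply/(@cvgrPdist_le _ _ _ (nbhs v)) => e e0.
  have K0 : 0 < a * N + 1 by rewrite ltr_wpDl// mulr_ge0.
  near=> u; rewrite (le_trans (hlip _ _))//.
  have uv : `|v - u| <= e / (a * N + 1).
    near: u; apply: (@cvgr_dist_le _ _ _ (nbhs v) _ id v);
      [exact: cvg_id | by rewrite divr_gt0].
  rewrite (@le_trans _ _ ((a * N + 1) * `|v - u|))//.
    by rewrite ler_wpM2r// lerDl.
  by rewrite mulrC -ler_pdivlMr.
pose A := [set v : 'rV[F]_(m * n) | `|v| = 1].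
(* The unit sphere is empty exactly when the space of matrices is trivial. *)
have [[v0 Av0]|A0] := pselect (A !=set0); last first.
  exists 0 => // M; rewrite mul0r.
  have [->|M0] := eqVneq M 0.
    by rewrite /mxsum big1// => i _; rewrite big1// => j _; rewrite mxE normr0.
  case: A0; exists (`|mxvec M|^-1 *: mxvec M); rewrite /A /= normrZ normfV normr_id.
  by rewrite mulVf// normr_eq0 mxvec_eq0.
have Ac : compact A.
  apply: bounded_closed_compact.
    exists 1; split => // x x1 v /= ->; exact: ltW.
  have -> : A = (fun v : 'rV[F]_(m * n) => `|v|) @^-1` [set x | x = 1] by [].
  apply: preimage_closed => [v _|]; first exact: norm_continuous.
  exact: closed_eq.
have [c cA cmin] := EVT_min_rV (ex_intro _ v0 Av0) Ac (continuous_subspaceT hcont).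
have hc : 0 < h c.
  apply: mxnorm_gt0; rewrite vec_mx_eq0; apply: contraTneq cA => ->.
  by apply/negP; rewrite inE /A /= normr0 => /eqP; rewrite eq_sym oner_eq0.
exists (N / h c); first by rewrite divr_ge0// ltW.
move=> M; have [->|M0] := eqVneq M 0.
  by rewrite mxnorm0 mulr0 /mxsum big1// => i _; rewrite big1// => j _; rewrite mxE normr0.
set v := mxvec M; have v0' : 0 < `|v| by rewrite normr_gt0 mxvec_eq0.
have : h c <= h (`|v|^-1 *: v).
  apply: cmin; rewrite inE /A /= normrZ normfV normr_id mulVf//.
  by rewrite gt_eqF.
rewrite /h linearZ /= mxvecK; case: nuP => _ nuZ _; rewrite nuZ normfV normr_id.
rewrite mulrC ler_pdivlMr// => cM.
rewrite -{1}[M]mxvecK (le_trans (vec_le _))// -[leRHS]mulrA ler_wpM2l//.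
by rewrite mulrC ler_pdivlMr// mulrC.
Unshelve. all: by end_near. Qed.
End ArbitraryNorm.

Lemma mx_squeeze m n (u : nat -> 'M[F]_(m, n)) l (g : nat -> F) :
  (forall k, mxsum (u k - l) <= g k) -> g @ \oo --> 0 -> u @ \oo --> l.
Proof.
move=> ug g0; apply/cvgrPdist_le => e e0; near=> k.
rewrite distrC (le_trans (norm_le_mxsum _))// (le_trans (ug k))//.
rewrite (le_trans (ler_norm _))//; near: k.
by move/cvgr0Pnorm_le : g0; apply.
Unshelve. all: by end_near. Qed.

(** A nonincreasing nonnegative sequence converges, so its increments tend to
    [0]; a multiple of their squares dominates the sequence. *)
Lemma quadratic_decrease_cvg0 (f : nat -> F) c :
  (forall k, 0 <= f k) -> (forall k, f k.+1 <= f k) ->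
  (forall k, f k.+1 <= c * (f k - f k.+1) ^+ 2) -> f @ \oo --> 0.
Proof.
move=> f0 fd fq.
have fl : cvgn f.
  apply: nonincreasing_is_cvgn; first exact/nonincreasing_seqP.
  by exists 0 => _ [k _ <-].
set l := limn f in fl *; have {}fl : f @ \oo --> l by [].
have fS : [sequence f k.+1]_k @ \oo --> l by rewrite cvg_shiftS.
have dl : (fun k => c * (f k - f k.+1) ^+ 2) @ \oo --> 0.
  have -> : 0 = c * (l - l) ^+ 2 by rewrite subrr expr0n mulr0.
  apply: cvgMr; rewrite expr2; under eq_fun do rewrite expr2.
  by apply: cvgM; apply: cvgB.
rewrite -cvg_shiftS; apply: squeeze_cvgr (cvg_cst 0) dl.
by near=> k; rewrite f0 fq.
Unshelve. all: by end_near. Qed.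
End MatrixNorms.

(** * The iteration for a positive weight *)
Section PositiveWeight.
Variables (F : realType) (n m p : nat).
Variables (A E : 'M[F]_n) (B S : 'M[F]_(n, m)) (C : 'M[F]_(p, n)).
Variables (Q : 'M[F]_p) (R : 'M[F]_m) (Xs : 'M[F]_n).
Hypotheses (Eu : E \in unitmx) (Qs : Q^T = Q) (Ru : R \in unitmx) (Rpos : posdefmx R).
Hypothesis XsP : stabilizing_solution A E B S C Q R Xs.

Let Xss : Xs^T = Xs. Proof. by case: XsP. Qed.
Let Xs0 : riccati A E B S C Q R Xs = 0. Proof. by case: XsP. Qed.
Let Xst : pencil_stable E (A - B *m feedback E B S R Xs). Proof. by case: XsP. Qed.

Section Iterates.
Variables (K0 : 'M[F]_(m, n)) (X : nat -> 'M[F]_n) (K : nat -> 'M[F]_(m, n)).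
Hypothesis K0st : pencil_stable E (A - B *m K0).
Hypothesis nk : newton_kleinman A E B S C Q R K0 X K.

Let resX k : nk_residual A E B S C Q R (K k) (X k.+1) = 0.
Proof. exact: (nk.2 k).1. Qed.

Let KS k : K k.+1 = feedback E B S R (X k.+1). Proof. exact: (nk.2 k).2. Qed.

Let resX' k : nk_residual A E B S C Q R (feedback E B S R (X k.+1)) (X k.+2) = 0.
Proof. by rewrite -KS. Qed.

Lemma iterates_stable k : pencil_stable E (A - B *m K k).
Proof.
elim: k => [|k IH]; first by rewrite nk.1.
rewrite KS; exact: (newton_stable Eu Qs Ru Rpos Xss Xs0 IH (resX k)).
Qed.

Lemma iterates_ge_solution k : loewner_ge (X k.+1) Xs.
Proof. exact: (newton_ge_solution Eu Qs Ru Rpos Xss Xs0 (@iterates_stable k) (resX k)). Qed.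

Lemma iterates_decrease k : loewner_ge (X k.+1) (X k.+2).
Proof.
exact: (newton_monotone Eu Qs Ru Rpos Xss Xs0 (@iterates_stable k) (resX k) (resX' k)).
Qed.

Let f k := \tr (X k.+1 - Xs).

Let f_sub k : \tr (X k.+1 - X k.+2) = f k - f k.+1.
Proof. by rewrite /f -[RHS]linearB /= opprB addrA subrK. Qed.

Let f_ge0 k : 0 <= f k. Proof. exact/psd_mxtrace_ge0/iterates_ge_solution. Qed.

Let f_decr k : f k.+1 <= f k.
Proof. by rewrite -subr_ge0 -f_sub; exact/psd_mxtrace_ge0/iterates_decrease. Qed.

Let f_sub_le k : (f k - f k.+1) ^+ 2 <= f k ^+ 2.
Proof. by rewrite lerXn2r ?nnegrE ?subr_ge0// gerBl. Qed.

Lemma trace_error_quadratic : exists2 c, 0 <= c &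
  forall k, f k.+1 <= c * (f k - f k.+1) ^+ 2.
Proof.
have [c c0 cP] := newton_trace_bound Eu Qs Ru Rpos Xss Xs0 Xst.
exists c => // k; rewrite -f_sub; exact: cP (@iterates_stable k) (resX k) (resX' k).
Qed.

Lemma trace_error_cvg0 : f @ \oo --> 0.
Proof. by have [c _] := trace_error_quadratic; exact: quadratic_decrease_cvg0. Qed.

Lemma iterates_cvg : X @ \oo --> Xs.
Proof.
rewrite -cvg_shiftS; apply: (@mx_squeeze _ _ _ _ _ (fun k => n%:R * f k)).
  by move=> k; exact/psd_mxsum_le/iterates_ge_solution.
by rewrite -(mulr0 n%:R); apply: cvgMr; exact: trace_error_cvg0.
Qed.

Lemma riccati_iterates_cvg : (riccati A E B S C Q R (X k) @[k --> \oo]) --> (0 : 'M[F]_n).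
Proof.
have [c c0 cP] := mxsum_sq_fb_sub E B S R.
(* The residual at [X k.+2] is minus the square of the change of gain between
   [X k.+1] and [X k.+2]; this has no analogue for the first two indices. *)
rewrite -cvg_shiftS -cvg_shiftS.
apply: (@mx_squeeze _ _ _ _ _ (fun k => c * (f k * f k))).
  move=> k /=; rewrite subr0.
  have st : pencil_stable E (A - B *m feedback E B S R (X k.+1)).
    by rewrite -KS; exact: iterates_stable.
  rewrite (newton_riccati Eu Qs Ru Rpos st (resX' k)) mxsumN.
  apply: (le_trans (cP _ _ (iterates_decrease k))).
  by rewrite f_sub -expr2 ler_wpM2l.
rewrite -(mulr0 c); apply: cvgMr; rewrite -(mulr0 0).
by apply: cvgM; exact: trace_error_cvg0.
Qed.

Lemma iterates_quadratic : quadratic_convergence X Xs.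
Proof.
split; first exact: iterates_cvg.
move=> nu nuP; have [c c0 cP] := trace_error_quadratic.
have [a a0 aP] := mxnorm_le_mxsum nuP; have [b b0 bP] := mxsum_le_mxnorm nuP.
exists (a * n%:R * c * b ^+ 2); first by rewrite !mulr_ge0 ?exprn_ge0.
case=> // k _; set y := nu (X k.+1 - Xs).
have -> : a * n%:R * c * b ^+ 2 * y ^+ 2 = a * (n%:R * (c * (b * y) ^+ 2)) by ring.
apply: (le_trans (aP _)); rewrite ler_wpM2l//.
apply: (le_trans (psd_mxsum_le (iterates_ge_solution _))); rewrite ler_wpM2l//.
apply: (le_trans (cP k)); rewrite ler_wpM2l// (le_trans (f_sub_le k))//.
rewrite lerXn2r ?nnegrE ?mulr_ge0 ?(mxnorm_ge0 nuP)//.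
exact: (le_trans (mxtrace_le_mxsum _) (bP _)).
Qed.
End Iterates.
End PositiveWeight.

(** * Change of sign and the general case *)
Section SignChange.
Variables (F : realType) (n m p : nat).
Variables (A E : 'M[F]_n) (B S : 'M[F]_(n, m)) (C : 'M[F]_(p, n)).
Variables (Q : 'M[F]_p) (R : 'M[F]_m).
Hypothesis Ru : R \in unitmx.

Lemma invmxN (k : nat) (M : 'M[F]_k) : M \in unitmx -> invmx (- M) = - invmx M.
Proof.
move=> Mu; have N1u : (-1 : F) \is a GRing.unit by rewrite unitrN1.
by rewrite -scaleN1r invmxZ ?unitmxZ// invrN1 scaleN1r.
Qed.

Lemma feedbackN X : feedback E B (- S) (- R) (- X) = feedback E B S R X.
Proof.
rewrite /feedback invmxN// [(- S)^T]linearN /= !(mulmxN, mulNmx) -opprD.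
by rewrite mulmxN opprK.
Qed.

Lemma riccatiN X : riccati A E B (- S) C (- Q) (- R) (- X) = - riccati A E B S C Q R X.
Proof.
rewrite /riccati invmxN// [(- S)^T]linearN /= !(mulmxN, mulNmx) -!opprD.
by rewrite [(- _)^T]linearN /= !(mulmxN, mulNmx) !opprK.
Qed.

Lemma stabilizing_solutionN X : stabilizing_solution A E B S C Q R X ->
  stabilizing_solution A E B (- S) C (- Q) (- R) (- X).
Proof.
case=> Xs X0 Xst; split; last by rewrite feedbackN.
  by rewrite [LHS]linearN /= Xs.
by rewrite riccatiN X0 oppr0.
Qed.

Lemma newton_kleinmanN K0 X K : newton_kleinman A E B S C Q R K0 X K ->
  newton_kleinman A E B (- S) C (- Q) (- R) K0 (fun k => - X k) K.
Proof.
case=> KK nk; split=> // k; have [LX KX] := nk k; split; last by rewrite feedbackN.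
have WN : nk_W (- S) C (- R) (K k) = nk_W S C R (K k).
  by rewrite /nk_W invmxN// [(- S)^T]linearN /= mulmxN mulNmx opprK.
have TN : nk_T (- Q) (- R) = - nk_T Q R.
  by rewrite /nk_T !opp_block_mx !oppr0.
move: LX; rewrite /nk_lyapunov WN TN => LX.
by rewrite !(mulmxN, mulNmx) -!opprD LX oppr0.
Qed.

Lemma negdefmxN : negdefmx R -> posdefmx (- R).
Proof.
case=> Rs R0; split; first by rewrite [LHS]linearN /= Rs.
by move=> x x0; rewrite quadformN oppr_gt0 R0.
Qed.

Lemma loewner_geN (M N : 'M[F]_n) : loewner_ge (- M) (- N) -> loewner_le M N.
Proof.
rewrite /loewner_ge -opprD => -[Ms M0]; split.
  by apply: oppr_inj; rewrite -[RHS]Ms [RHS]linearN.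
by move=> x; have := M0 x; rewrite quadformN oppr_ge0.
Qed.

Lemma quadratic_convergenceN (X : nat -> 'M[F]_n) Xl :
  quadratic_convergence (fun k => - X k) (- Xl) -> quadratic_convergence X Xl.
Proof.
case=> cX qX; split; first by rewrite -(cvgNP X Xl).
move=> nu nuP; have [c c0 cP] := qX nu nuP; exists c => // k k1.
by have := cP k k1; rewrite -!opprD !(mxnormN nuP).
Qed.
End SignChange.

Theorem theorem1 (F : realType) (n m p : nat)
    (A E : 'M[F]_n) (B S : 'M[F]_(n, m)) (C : 'M[F]_(p, n))
    (Q : 'M[F]_p) (R : 'M[F]_m) (Xs : 'M[F]_n) (K0 : 'M[F]_(m, n))
    (X : nat -> 'M[F]_n) (K : nat -> 'M[F]_(m, n)) :
  E \in unitmx ->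
  Q^T = Q ->
  R^T = R ->
  R \in unitmx ->
  unique (stabilizing_solution A E B S C Q R) Xs ->
  pencil_stable E (A - B *m K0) ->
  posdefmx R \/ negdefmx R ->
  newton_kleinman A E B S C Q R K0 X K ->
  (* (i) *)
  (forall k : nat, pencil_stable E (A - B *m K k)) /\
  (* (ii) *)
  ((X k @[k --> \oo] --> Xs) /\
   (riccati A E B S C Q R (X k) @[k --> \oo] --> (0 : 'M[F]_n))) /\
  (* (iii) *)
  (forall (K0' : 'M[F]_(m, n)) (X' : nat -> 'M[F]_n)
      (K' : nat -> 'M[F]_(m, n)),
    pencil_stable E (A - B *m K0') ->
    newton_kleinman A E B S C Q R K0' X' K' ->
    quadratic_convergence X' Xs) /\
  (* (iv) *)
  (posdefmx R ->
    forall k : nat, (1 <= k)%N ->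
      loewner_ge (X k) (X k.+1) /\ loewner_ge (X k) Xs) /\
  (negdefmx R ->
    forall k : nat, (1 <= k)%N ->
      loewner_le (X k) (X k.+1) /\ loewner_le (X k) Xs).
Proof.
move=> Eu Qs _ Ru [XsP _] K0st Rdef nk.
have QsN : (- Q)^T = - Q by rewrite [LHS]linearN /= Qs.
have RuN : - R \in unitmx.
  by rewrite -scaleN1r unitmxZ ?unitrN1.
have XsN := stabilizing_solutionN Ru XsP; have nkN := newton_kleinmanN Ru nk.
split; [|split; [split|split; [|split]]].
- case: Rdef => [Rp|/negdefmxN Rn].
    exact: (iterates_stable Eu Qs Ru Rp XsP K0st nk).
  exact: (iterates_stable Eu QsN RuN Rn XsN K0st nkN).
- case: Rdef => [Rp|/negdefmxN Rn].
    exact: (iterates_cvg Eu Qs Ru Rp XsP K0st nk).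
  rewrite -(cvgNP X Xs); exact: (iterates_cvg Eu QsN RuN Rn XsN K0st nkN).
- case: Rdef => [Rp|/negdefmxN Rn].
    exact: (riccati_iterates_cvg Eu Qs Ru Rp XsP K0st nk).
  have := riccati_iterates_cvg Eu QsN RuN Rn XsN K0st nkN.
  under eq_fun do rewrite riccatiN//.
  rewrite -[X in _ --> X -> _]oppr0 => cN.
  by apply/(cvgNP (fun k => riccati A E B S C Q R (X k)) 0).
- move=> K0' X' K' K0st' nk'; case: Rdef => [Rp|/negdefmxN Rn].
    exact: (iterates_quadratic Eu Qs Ru Rp XsP K0st' nk').
  apply: quadratic_convergenceN.
  exact: (iterates_quadratic Eu QsN RuN Rn XsN K0st' (newton_kleinmanN Ru nk')).
- move=> Rp [|k] // _; split.
    exact: (iterates_decrease Eu Qs Ru Rp XsP K0st nk).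
  exact: (iterates_ge_solution Eu Qs Ru Rp XsP K0st nk).
- move=> /negdefmxN Rn [|k] // _; split; apply: loewner_geN.
    exact: (iterates_decrease Eu QsN RuN Rn XsN K0st nkN).
  exact: (iterates_ge_solution Eu QsN RuN Rn XsN K0st nkN).
Qed.
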